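(* Let $\beta\in\mathbb{R}$ and let $\psi$ be a state on $C^*(G,P)$. Then $\psi$ is a KMS$_\beta$ state of $(C^*(G,P),\alpha)$ if and only if for all $x,y\in P$ we have \[ \psi(T_xT_y^* ) = \begin{cases} e^{-\beta \theta(x)}\psi(T_{y^{-1}x}) & \text{if $\theta(x)=\theta(y)$ and $x \vee y = x$}\\ e^{-\beta \theta(x)}\psi(T_{x^{-1}y}^* ) & \text{if $\theta(x)=\theta(y)$ and $x \vee y = y$}\\ 0 & \text{otherwise.} \end{cases} \]
   Context: Fix positive integers $c,d$. $G=\mathrm{BS}(c,d)=\langle a,b: ab^c=b^da\rangle$ is the Baumslag-Solitar group, $P$ is the submonoid of $G$ generated by $a$ and $b$, and $\theta:G\to\mathbb{Z}$ is the homomorphism with $\theta(a)=1$, $\theta(b)=0$. Order: for $g,h\in G$, $g\leq h$ means $g^{-1}h\in P$. It is known (Spielberg) that $(G,P)$ is quasi-lattice ordered: $P\cap P^{-1}=\{e\}$, and every pair $g,h\in G$ with a common upper bound in $P$ has a least upper bound $g\vee h$ in $P$. Write $g\vee h<\infty$ if a common upper bound in $P$ exists and $g\vee h=\infty$ otherwise. A Nica-covariant representation of $P$ is a map $x\mapsto S_x$ of $P$ into the isometries of a unital $C^*$-algebra with $S_e=1$, $S_xS_y=S_{xy}$, and $S_xS_x^*S_yS_y^*=S_{x\vee y}S_{x\vee y}^*$ if $x\vee y<\infty$ and $=0$ if $x\vee y=\infty$. $C^*(G,P)$ is the $C^*$-algebra generated by a universal Nica-covariant representation $T:P\to C^*(G,P)$;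 it is the closed linear span of $\{T_xT_y^*:x,y\in P\}$. The dynamics $\alpha:\mathbb{R}\to\mathrm{Aut}\,C^*(G,P)$ is given by $\alpha_t(T_x)=e^{it\theta(x)}T_x$. For $\beta\in\mathbb{R}$, a state $\psi$ of $C^*(G,P)$ is a KMS$_\beta$ state if and only if $\psi((T_xT_y^* )(T_pT_q^* ))=e^{-\beta(\theta(x)-\theta(y))}\psi((T_pT_q^* )(T_xT_y^* ))$ for all $x,y,p,q\in P$ and, when $\beta=0$, $\psi$ is in addition $\alpha$-invariant. *)

(* Defs.v *)
From HB Require Import structures.
From mathcomp Require Import all_boot all_order all_algebra.
From mathcomp Require Import all_classical all_reals all_analysis.
From mathcomp Require Import complex.

Set Implicit Arguments.
Unset Strict Implicit.
Unset Printing Implicit Defensive.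

Import Order.TTheory GRing.Theory Num.Theory.
Import numFieldNormedType.Exports.

Local Open Scope classical_set_scope.
Local Open Scope ring_scope.
Local Open Scope complex_scope.

(* A letter is a pair (generator, inverted?): the generator is a for [true]
   and b for [false].  BS(c,d) is the quotient of the monoid of words by the
   congruence generated by free cancellation and the defining relator. *)
Definition word := seq (bool * bool).

Definition letter_a : bool * bool := (true, false).
Definition letter_b : bool * bool := (false, false).
Definition inv_letter (l : bool * bool) := (l.1, ~~ l.2).
Definition inv_word (w : word) : word := rev (map inv_letter w).

Inductive bs_eqv (c d : nat) : word -> word -> Prop :=
| bs_refl u : bs_eqv c d u u
| bs_sym u v : bs_eqv c d u v -> bs_eqv c d v u
| bs_trans u v w : bs_eqv c d u v -> bs_eqv c d v w -> bs_eqv c d u w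
| bs_cat u v u' v' :
    bs_eqv c d u v -> bs_eqv c d u' v' -> bs_eqv c d (u ++ u') (v ++ v')
| bs_cancel l : bs_eqv c d [:: l; inv_letter l] [::]
| bs_relator :
    bs_eqv c d (letter_a :: nseq c letter_b) (rcons (nseq d letter_b) letter_a).

Section BSgroup.
Variables c d : nat.

Definition bs_rel (u v : word) : bool := `[< bs_eqv c d u v >].

Lemma bs_rel_equiv : equiv_class_of bs_rel.
Proof.
split.
- by move=> u; apply/asboolP; exact: bs_refl.
- by move=> u v; apply/asboolP/asboolP; exact: bs_sym.
- move=> v u w /asboolP uv /asboolP vw; apply/asboolP; exact: bs_trans uv vw.
Qed.

Canonical bs_equiv := EquivRelPack bs_rel_equiv.

Definition BS := {eq_quot bs_equiv}%qT.
HB.instance Definition _ := Choice.on BS.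
HB.instance Definition _ := EqQuotient.on BS.

Definition BS_of (w : word) : BS := (\pi_BS w)%qT.

Definition BS_mul (g h : BS) : BS := BS_of (repr g ++ repr h).
Definition BS_one : BS := BS_of [::].
Definition BS_inv (g : BS) : BS := BS_of (inv_word (repr g)).

Lemma BS_ofP (u v : word) : BS_of u = BS_of v <-> bs_eqv c d u v.
Proof.
split; first by move/eqmodP/asboolP.
by move=> uv; apply/eqmodP/asboolP.
Qed.

Lemma BS_reprK (g : BS) : BS_of (repr g) = g.
Proof. exact: reprK. Qed.

Lemma repr_BS_of (w : word) : bs_eqv c d (repr (BS_of w)) w.
Proof. by apply/BS_ofP; rewrite BS_reprK. Qed.

Lemma BS_mulE (u v : word) : BS_mul (BS_of u) (BS_of v) = BS_of (u ++ v).
Proof. by apply/BS_ofP; apply: bs_cat; exact: repr_BS_of. Qed.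

Lemma inv_letterK : involutive inv_letter.
Proof. by case=> g e; rewrite /inv_letter /= negbK. Qed.

Lemma inv_wordK : involutive inv_word.
Proof.
by move=> w; rewrite /inv_word map_rev revK -map_comp map_id_in // => l _;
exact: inv_letterK.
Qed.

Lemma bs_inv_wordr (w : word) : bs_eqv c d (w ++ inv_word w) [::].
Proof.
elim: w => [|l w IH]; first exact: bs_refl.
have -> : (l :: w) ++ inv_word (l :: w) =
    [:: l] ++ ((w ++ inv_word w) ++ [:: inv_letter l]).
  by rewrite /inv_word /= rev_cons -cats1 -catA.
apply: bs_trans (bs_cancel c d l); apply: (@bs_cat _ _ [:: l] [:: l]).
  exact: bs_refl.
exact: (bs_cat IH (bs_refl _ _ [:: inv_letter l])).
Qed.

Lemma BS_mulA : associative BS_mul.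
Proof.
move=> x y z; rewrite -[x]BS_reprK -[y]BS_reprK -[z]BS_reprK.
by rewrite !BS_mulE catA.
Qed.

Lemma BS_mul1 : left_id BS_one BS_mul.
Proof. by move=> x; rewrite -[x]BS_reprK BS_mulE. Qed.

Lemma BS_1mul : right_id BS_one BS_mul.
Proof. by move=> x; rewrite -[x]BS_reprK BS_mulE cats0. Qed.

Lemma BS_mulV : right_inverse BS_one BS_inv BS_mul.
Proof.
by move=> x; rewrite -{1}[x]BS_reprK BS_mulE; apply/BS_ofP; exact: bs_inv_wordr.
Qed.

Lemma BS_Vmul : left_inverse BS_one BS_inv BS_mul.
Proof.
move=> x; rewrite -{2}[x]BS_reprK BS_mulE; apply/BS_ofP.
by rewrite -{2}[repr x]inv_wordK; exact: bs_inv_wordr.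
Qed.

HB.instance Definition _ :=
  isGroup.Build BS BS_mulA BS_mul1 BS_1mul BS_Vmul BS_mulV.

Definition BSa : BS := BS_of [:: letter_a].
Definition BSb : BS := BS_of [:: letter_b].

Lemma BS_relation : (BSa * BSb ^+ c = BSb ^+ d * BSa)%g.
Proof.
have bn n : (BSb ^+ n)%g = BS_of (nseq n letter_b).
  by elim: n => [|n IH]; rewrite ?expg0 // expgS IH [LHS]BS_mulE.
rewrite !bn [LHS]BS_mulE [RHS]BS_mulE; apply/BS_ofP.
by rewrite cats1; exact: bs_relator.
Qed.

(* theta is computed on a word as its exponent sum in a; [theta_a], [theta_b]
   and [thetaM] say that it is the homomorphism with a |-> 1 and b |-> 0. *)
Definition exp_sum (w : word) : int :=
  \sum_(l <- w) (if l.1 then (-1) ^+ l.2 else 0).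

Definition theta (g : BS) : int := exp_sum (repr g).

Lemma exp_sum_eqv (u v : word) : bs_eqv c d u v -> exp_sum u = exp_sum v.
Proof.
have b0 n : exp_sum (nseq n letter_b) = 0.
  by rewrite /exp_sum big_nseq_cond /=; elim: n => //= n ->.
rewrite /exp_sum; elim=> //=.
- by move=> {}u {}v w _ -> _ ->.
- by move=> {}u {}v u' v' _ Hu _ Hv; rewrite !big_cat /= Hu Hv.
- by case=> -[] []; rewrite !big_cons !big_nil.
- by rewrite -cats1 big_cat big_cons big_seq1 /= -!/(exp_sum _) !b0 addrC.
Qed.

Lemma theta_of (w : word) : theta (BS_of w) = exp_sum w.
Proof. by apply: exp_sum_eqv; exact: repr_BS_of. Qed.

Lemma theta_a : theta BSa = 1.
Proof. by rewrite theta_of /exp_sum big_seq1. Qed.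

Lemma theta_b : theta BSb = 0.
Proof. by rewrite theta_of /exp_sum big_seq1. Qed.

Lemma thetaM (g h : BS) : theta (g * h)%g = theta g + theta h.
Proof. by rewrite [LHS]theta_of /exp_sum big_cat. Qed.

Inductive inP : BS -> Prop :=
| inP_1 : inP 1%g
| inP_a : inP BSa
| inP_b : inP BSb
| inP_mul g h : inP g -> inP h -> inP (g * h)%g.

Definition BSle (g h : BS) : Prop := inP (g^-1 * h)%g.

Definition is_ub (x y z : BS) : Prop := [/\ inP z, BSle x z & BSle y z].

(* x \/ y is encoded as a relation: [is_join x y z] says that x \/ y < oo and
   x \/ y = z, [join_infty x y] that x \/ y = oo. *)
Definition is_join (x y z : BS) : Prop :=
  is_ub x y z /\ forall w, is_ub x y w -> BSle z w.

Definition join_infty (x y : BS) : Prop := forall z, ~ is_ub x y z.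

End BSgroup.

(* Banach *-algebra over R[i] with the C*-identity.  The norm is a real-valued
   field rather than that of a [normedModType R[i]], because the latter
   structure has no join with [algType R[i]] in the library hierarchy. *)
HB.mixin Record isCStarAlgebra (R : realType) A of GRing.Algebra R[i] A := {
  star : A -> A ;
  cnorm : A -> R ;
  starK : involutive star ;
  starD : forall x y, star (x + y) = star x + star y ;
  starZ : forall (k : R[i]) x, star (k *: x) = k^* *: star x ;
  starM : forall x y, star (x * y) = star y * star x ;
  cnorm_eq0 : forall x, cnorm x = 0 -> x = 0 ;
  cnormD : forall x y, cnorm (x + y) <= cnorm x + cnorm y ;
  cnormZ : forall (k : R[i]) x, cnorm (k *: x) = Normc.normc k * cnorm x ;
  cnormM : forall x y, cnorm (x * y) <= cnorm x * cnorm y ;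
  cnorm_star : forall x, cnorm (star x * x) = cnorm x ^+ 2 ;
  cnorm_complete : forall u : nat -> A,
    (forall e, 0 < e -> exists N : nat, forall m n, (N <= m)%N -> (N <= n)%N ->
       cnorm (u m - u n) < e) ->
    exists l, (fun n => cnorm (u n - l)) @ \oo --> (0 : R)
}.

#[short(type="cstarAlgType")]
HB.structure Definition CStarAlgebra (R : realType) :=
  { A of isCStarAlgebra R A & GRing.Algebra R[i] A }.

Section CStar.
Variable R : realType.
Implicit Types A B : cstarAlgType R.

Definition star_preserving A B (f : A -> B) : Prop :=
  forall x, f (star x) = star (f x).

Definition norm_closed A (C : set A) : Prop :=
  forall x, (forall e, 0 < e -> exists2 y, C y & cnorm (x - y) < e) -> C x.

(* The smallest norm-closed unital *-subalgebra containing X is everything. *)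
Definition generates A (X : set A) : Prop :=
  forall C : set A,
    norm_closed C -> X `<=` C -> C 1 ->
    (forall x y, C x -> C y -> C (x + y)) ->
    (forall (k : R[i]) x, C x -> C (k *: x)) ->
    (forall x y, C x -> C y -> C (x * y)) ->
    (forall x, C x -> C (star x)) ->
    C = setT.

(* A state is a positive linear functional of norm one; for a positive
   functional on a unital algebra the norm is the value at 1. *)
Definition is_state A (psi : {scalar A}) : Prop :=
  [/\ forall x, 0 <= psi (star x * x),
      forall x, Normc.normc (psi x) <= cnorm x
    & psi 1 = 1].

(* A strongly continuous action of the real line by automorphisms.  The
   isometry clause is automatic for *-automorphisms of a C*-algebra;
   bijectivity follows from the action axioms. *)
Definition is_dynamics A (alpha : R -> {lrmorphism A -> A}) : Prop :=
  [/\ forall t, star_preserving (alpha t),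
      forall t x, cnorm (alpha t x) = cnorm x,
      forall x, alpha 0 x = x,
      forall s t x, alpha (s + t) x = alpha s (alpha t x)
    & forall x s, (fun t => cnorm (alpha t x - alpha s x)) @ s --> (0 : R)].

Section Nica.
Variables c d : nat.
Local Notation G := (BS c d).

(* A representation of P is given by a function on all of G, of which only
   the values on P are ever used.  By the quasi-lattice property exactly one
   of the last two clauses applies to each pair x, y in P. *)
Definition nica_covariant A (S : G -> A) : Prop :=
  [/\ forall x, inP x -> star (S x) * S x = 1,
      S 1%g = 1,
      forall x y, inP x -> inP y -> S (x * y)%g = S x * S y,
      forall x y z, inP x -> inP y -> is_join x y z ->
        S x * star (S x) * (S y * star (S y)) = S z * star (S z)
    & forall x y, inP x -> inP y -> join_infty x y ->
        S x * star (S x) * (S y * star (S y)) = 0].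

(* [(A, T)] is C*(G,P) with its universal representation.  The morphism pi is
   unique because T generates A. *)
Definition is_universal_nica A (T : G -> A) : Prop :=
  [/\ nica_covariant T,
      generates [set T x | x in @inP c d]
    & forall B (S : G -> B), nica_covariant S ->
        exists2 pi : {lrmorphism A -> B},
          star_preserving pi & forall x, inP x -> pi (T x) = S x].

Definition expi (u : R) : R[i] := cos u +i* sin u.

Definition is_theta_dynamics A (T : G -> A) (alpha : R -> {lrmorphism A -> A})
    : Prop :=
  is_dynamics alpha /\
  forall t x, inP x -> alpha t (T x) = expi (t * (theta x)%:~R) *: T x.

(* The characterization of KMS states on the spanning elements T_x T_y^*. *)
Definition is_KMS A (T : G -> A) (alpha : R -> {lrmorphism A -> A}) (beta : R)
    (psi : {scalar A}) : Prop :=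
  [/\ is_state psi,
      forall x y p q, inP x -> inP y -> inP p -> inP q ->
        psi ((T x * star (T y)) * (T p * star (T q))) =
        (expR (- beta * (theta x - theta y)%:~R))%:C *
          psi ((T p * star (T q)) * (T x * star (T y)))
    & beta = 0 -> forall t a, psi (alpha t a) = psi a].

End Nica.
End CStar.

(* Main.v *)
Require Import Defs.
From mathcomp Require Import all_boot all_order all_algebra.
From mathcomp Require Import all_classical all_reals all_analysis.
From mathcomp Require Import complex ring lra zify.
Import Order.TTheory GRing.Theory Num.Theory numFieldNormedType.Exports.
Local Open Scope ring_scope.
Local Open Scope complex_scope.

Set Implicit Arguments.
Unset Strict Implicit.
Unset Printing Implicit Defensive.

(** The proof has a combinatorial half in the group and an algebraic half in
    the C*-algebra.

    In the group, everything rests on one fact ([ub_comparable]): two elements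
    x, y of P of equal degree with a common upper bound differ by a power of b,
    so that one lies below the other.  Indeed an element of P can be written
    b^(s_0) a b^(s_1) a ... b^(s_(k-1)) a b^m with k its degree and every s_i
    in [0, d), by moving blocks b^d to the right with b^d a = a b^c; right
    multiplication by an element of P only extends the stem s_0, ..., s_(k-1),
    so x and y have the same stem.  This needs the stem to be determined by the
    group element, which is the normal form theorem for the HNN extension; it
    is obtained by the van der Waerden method, letting words act on normal
    forms from the right and checking that the defining relations act
    trivially ([act_eqv]).  It follows that x \/ y exists as soon as there is
    an upper bound, and then has the larger of the two degrees
    ([join_exists]).

    In the algebra, Nica covariance turns T_y^* T_p into 0 or T_(y') T_(p')^*
    with y y' = p p' = y \/ p.  If psi is KMS, then
    psi(T_x T_y^* ) = e^(-beta theta(x)) psi(T_y^* T_x), which is the displayed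
    formula when x and y are comparable with equal degree and is 0 when
    x \/ y = oo; by [ub_comparable] the only other possibility is
    theta(x) <> theta(y), where the value vanishes, by invariance under alpha if
    beta = 0 and by the KMS condition against the unit otherwise
    ([KMS_comparison]).

    Conversely, given the formula, both sides of
    psi(T_x T_p T_q^* ) = e^(-beta theta(x)) psi(T_p T_q^* T_x) are given by
    it, since T_q^* T_x is again a monomial; they agree because
    q^-1 (x p) is a power of b exactly when x'^-1 (p q') is the same power,
    where q q' = x x' = q \/ x ([formula_twist]).  Taking adjoints gives the
    identity for T_y^*, and the two together give the KMS condition.  For
    beta = 0 invariance holds on monomials and passes to their closed linear
    span, which is the whole algebra ([monomial_span_full]). *)

(** * Normal forms in the Baumslag-Solitar group *)

Section NormalForms.
Variables c d : nat.
Hypotheses (hc : (0 < c)%N) (hd : (0 < d)%N).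

(** The exponents of b that may stand before a (for [e = true]) or before
    a^-1 in a normal form are the residues modulo this number. *)
Definition modulus (e : bool) : int := if e then d else c.

Lemma modulus_gt0 e : 0 < modulus e.
Proof. by case: e. Qed.

(** The pair (s, m) stands for the product of the syllables of s, the last
    one at the head of the list, followed by b^m; a syllable (e, t) is
    b^t a^(+1) if e and b^t a^(-1) otherwise. *)
Definition nf_state := (seq (bool * int) * int)%type.

(** Besides the ranges of the exponents, this forbids a^e b^0 a^(-e). *)
Fixpoint reduced (s : seq (bool * int)) : bool :=
  if s is (e, t) :: s' then
    [&& 0 <= t, t < modulus e,
        (if s' is (e', _) :: _ then (e' == e) || (t != 0) else true)
      & reduced s']
  else true.

(** Right multiplication by a^e: the multiple of the modulus contained in b^m
    passes through a^e and the residue forms a new syllable, unless the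
    residue is 0 and a^e cancels against the last syllable. *)
Definition push_a (e : bool) (st : nf_state) : nf_state :=
  let q := (st.2 %/ modulus e)%Z in
  let r := (st.2 %% modulus e)%Z in
  let keep := ((e, r) :: st.1, modulus (~~ e) * q) in
  if st.1 is (e', t) :: s' then
    if (e' != e) && (r == 0) then (s', t + modulus (~~ e) * q) else keep
  else keep.

Lemma push_a_reduced e st : reduced st.1 -> reduced (push_a e st).1.
Proof.
have m0 := modulus_gt0 e; have mn0 : modulus e != 0 by rewrite gt_eqF.
case: st => [[|[e' t] s] m] /=; rewrite /push_a /=.
  by rewrite modz_ge0 // ltz_pmod.
case/and4P => t0 tm st rs.
case: ifP => //= H.
rewrite modz_ge0 // ltz_pmod // t0 tm st rs /= andbT.
by case: eqP H => //= _ ->.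
Qed.

(** A cancellation is undone by creating the cancelled syllable again; that it
    is not in turn cancelled is where the state has to be reduced. *)
Lemma push_aK e st : reduced st.1 -> push_a (~~ e) (push_a e st) = st.
Proof.
have m0 := modulus_gt0 e; have mn0 : modulus e != 0 by rewrite gt_eqF.
have n0 := modulus_gt0 (~~ e); have nn0 : modulus (~~ e) != 0 by rewrite gt_eqF.
case: st => s m /= rs.
have back s' : push_a (~~ e) ((e, (m %% modulus e)%Z) :: s',
    modulus (~~ e) * (m %/ modulus e)%Z) = (s', m).
  have ne : e != ~~ e by case: (e).
  by rewrite /push_a /= modzMr eqxx andbT mulKz // negbK ne addrC mulrC -divz_eq.
case: s rs => [|[e' t] s] rs; first exact: back.
rewrite {2}/push_a /=; case: ifP => // /andP[ee /eqP r0].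
move: rs => /= /and4P[t0 tm hs _].
have {}ee : e' = ~~ e by case: (e) (e') ee => [] [].
subst e'.
have -> : t + modulus (~~ e) * (m %/ modulus e)%Z =
  (m %/ modulus e)%Z * modulus (~~ e) + t by rewrite addrC mulrC.
have qr : (((m %/ modulus e)%Z * modulus (~~ e) + t) %/ modulus (~~ e))%Z
    = (m %/ modulus e)%Z.
  have td : (t %/ modulus (~~ e))%Z = 0.
    by apply: divz_small; rewrite gtz0_abs //; apply/andP; split; [exact: t0|exact: tm].
  by rewrite divzMDl // td addr0.
rewrite /push_a /= qr modzMDl modz_small ?t0 // negbK.
have -> : modulus e * (m %/ modulus e)%Z = m.
  by rewrite mulrC [RHS](divz_eq m (modulus e)) r0 addr0.
case: s hs => // -[e' t'] s.
by case: (e' == ~~ e) => //= /negbTE ->.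
Qed.

Definition act_letter (st : nf_state) (l : bool * bool) : nf_state :=
  if l.1 then push_a (~~ l.2) st
  else (st.1, if l.2 then st.2 - 1 else st.2 + 1).

Definition act (st : nf_state) (w : word) : nf_state := foldl act_letter st w.

Lemma act_reduced w st : reduced st.1 -> reduced (act st w).1.
Proof.
elim: w st => //= -[g i] w IH st rs; apply: IH.
by case: g => //; exact: push_a_reduced.
Qed.

Lemma act_cat u v st : act st (u ++ v) = act (act st u) v.
Proof. by rewrite /act foldl_cat. Qed.

Lemma act_b n st : act st (nseq n letter_b) = (st.1, st.2 + n%:Z).
Proof.
elim: n st => [|n IH] [s m] /=; first by rewrite addr0.
by rewrite IH /= -addrA.
Qed.

(** Van der Waerden's argument: the relations of the group hold for the
    action on reduced states, so the state reached from (nil, 0) depends only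
    on the group element. *)
Lemma act_eqv u v : bs_eqv c d u v ->
  forall st, reduced st.1 -> act st u = act st v.
Proof.
elim=> //=.
- by move=> {}u {}v _ IH st rs; rewrite IH.
- by move=> {}u {}v w _ H1 _ H2 st rs; rewrite H1 // H2.
- move=> {}u {}v u' v' _ H1 _ H2 st rs.
  by rewrite !act_cat H1 // H2 //; exact: act_reduced.
- case=> -[] i [s m] rs; rewrite /act_letter /=.
    exact: push_aK.
  by case: i => /=; rewrite ?subrK ?addrK.
- move=> [s m] rs.
  rewrite -cats1 act_cat !act_b /= /act_letter /push_a /=.
  have dn0 : d%:Z != 0 by lia.
  rewrite modzDr [in RHS]addrC -[X in (X + m)%R]mul1r divzMDl // mulrDr mulr1.
  by case: s {rs} => [|[e t] s] /=; [|case: ifP => _ /=]; congr pair; ring.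
Qed.

Definition nf (g : BS c d) : nf_state := act ([::], 0) (repr g).

Lemma nf_of w : nf (BS_of c d w) = act ([::], 0) w.
Proof. by apply: act_eqv => //; exact: repr_BS_of. Qed.


(** * The positive monoid *)

Local Notation G := (BS c d).
Local Notation a := (BSa c d).
Local Notation b := (BSb c d).

Definition positive (w : word) : bool := all (fun l => ~~ l.2) w.

Lemma BS_of_cat u v : BS_of c d (u ++ v) = (BS_of c d u * BS_of c d v)%g.
Proof. exact: esym (BS_mulE c d u v). Qed.

Lemma inP_word (x : G) : inP x -> exists2 w, positive w & x = BS_of c d w.
Proof.
elim=> [|||g h _ [u pu ->] _ [v pv ->]].
- by exists [::].
- by exists [:: letter_a].
- by exists [:: letter_b].
- by exists (u ++ v); [rewrite /positive all_cat; apply/andP | rewrite BS_of_cat].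
Qed.

Lemma word_inP w : positive w -> inP (BS_of c d w).
Proof.
elim: w => [|[g i] w IH] /=; first by move=> _; exact: inP_1.
case: i => //= pw; rewrite -cat1s BS_of_cat; apply: inP_mul (IH pw).
by case: g; [exact: inP_a | exact: inP_b].
Qed.

Lemma inP_b_exp n : inP (b ^+ n)%g.
Proof.
elim: n => [|n IH]; first exact: inP_1.
by rewrite expgS; apply: inP_mul => //; exact: inP_b.
Qed.

Lemma b_expE n : (b ^+ n)%g = BS_of c d (nseq n letter_b).
Proof. by elim: n => // n IH; rewrite expgS IH [LHS]BS_mulE. Qed.

Lemma b_exp_inj m n : (b ^+ m = b ^+ n)%g -> m = n.
Proof.
by rewrite !b_expE => /(congr1 nf); rewrite !nf_of !act_b => -[].
Qed.

Lemma b_exp_a k : (b ^+ (d * k) * a = a * b ^+ (c * k))%g.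
Proof.
elim: k => [|k IH]; first by rewrite !muln0 mul1g mulg1.
by rewrite !mulnS !expgnDr -mulgA IH !mulgA BS_relation.
Qed.

Lemma theta_b_exp n : theta (b ^+ n)%g = 0.
Proof.
elim: n => [|n IH]; first by rewrite [LHS]theta_of /exp_sum big_nil.
by rewrite expgS thetaM theta_b IH.
Qed.

Lemma theta1 : theta (1 : G)%g = 0.
Proof. exact: (theta_b_exp 0). Qed.

Lemma theta_mulVg (x y : G) : theta (x^-1 * y)%g = theta y - theta x.
Proof.
by have := thetaM x (x^-1 * y)%g; rewrite mulVKg => ->; rewrite addrC addKr.
Qed.

Lemma push_a_stem (st : nf_state) : all fst st.1 ->
  push_a true st = ((true, (st.2 %% d)%Z) :: st.1, c%:Z * (st.2 %/ d)%Z).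
Proof. by case: st => [[|[[] t] s] m]. Qed.

(** Positive words never cancel, so they only extend the stem, by one
    syllable for each a. *)
Lemma act_positive w st : positive w -> all fst st.1 ->
  exists s, [/\ (act st w).1 = s ++ st.1, all fst (s ++ st.1)
              & (size s)%:Z = exp_sum w].
Proof.
elim: w st => [|[g i] w IH] st /=.
  by move=> _ ps; exists [::]; rewrite /exp_sum big_nil.
case: i => //= pw ps.
case: g; rewrite /act_letter /=.
  rewrite push_a_stem //.
  have [//|s [es pos sz]] := IH ((true, (st.2 %% d)%Z) :: st.1, c%:Z * (st.2 %/ d)%Z) pw.
  exists (rcons s (true, (st.2 %% d)%Z)).
  rewrite cat_rcons size_rcons; split => //.
  by rewrite /exp_sum big_cons /= -/(exp_sum w) -sz.
have [//|s [es pos sz]] := IH (st.1, st.2 + 1) pw.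
exists s; split => //.
by rewrite /exp_sum big_cons /= add0r.
Qed.

(** Meaningful for stems of positive elements, whose exponents are
    nonnegative and whose syllables all end in a. *)
Fixpoint stem_elt (s : seq (bool * int)) : G :=
  if s is (_, t) :: s' then (stem_elt s' * b ^+ `|t|%N * a)%g else 1%g.

(** On positive words the normal form is faithful: it can be multiplied back
    to the element it came from. *)
Lemma positive_nf w : positive w ->
  exists n : nat, [/\ all fst (act ([::], 0) w).1, (act ([::], 0) w).2 = n
    & BS_of c d w = (stem_elt (act ([::], 0) w).1 * b ^+ n)%g].
Proof.
elim/last_ind: w => [|w [g i] IH]; first by exists 0%N; rewrite mul1g.
rewrite /positive all_rcons /= => /andP[i0 /IH[n [pos e2 ew]]].
case: i i0 => // _.
rewrite -cats1 act_cat BS_of_cat {}ew.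
move: (act _ w) pos e2 => [s m] /= pos ->.
case: g; rewrite /act_letter /=.
  exists (c * (n %/ d))%N; rewrite push_a_stem //= pos modz_nat divz_nat.
  split=> //.
  rewrite -[RHS]mulgA -b_exp_a [in LHS](divn_eq n d) addnC mulnC expgnDr.
  by rewrite !mulgA.
exists (n + 1)%N; split=> //.
by rewrite -[LHS]mulgA -expgSr addn1.
Qed.

Lemma inP_theta_ge0 (x : G) : inP x -> 0 <= theta x.
Proof.
case/inP_word => w pw ->; rewrite theta_of.
by have [|s [_ _ <-]] := @act_positive w ([::], 0) pw.
Qed.

Lemma inP_theta0 (x : G) : inP x -> theta x = 0 -> exists n, x = (b ^+ n)%g.
Proof.
case/inP_word => w pw ->; rewrite theta_of => w0.
have [//|s [es _ sz]] := @act_positive w ([::], 0) pw.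
have [n [_ _ ew]] := positive_nf pw.
move: sz ew; rewrite w0 es => -[/size0nil ->]; rewrite mul1g => ew.
by exists n.
Qed.

(** Both stems are the initial part, of the common length [theta x], of the
    stem of the upper bound z, hence coincide; so x and y differ by a power
    of b. *)
Lemma ub_comparable (x y z : G) : inP x -> inP y -> theta x = theta y ->
  is_ub x y z -> (exists n, y = x * b ^+ n)%g \/ (exists n, x = y * b ^+ n)%g.
Proof.
move=> /inP_word[u pu ->] /inP_word[v pv ->]; rewrite !theta_of => uv.
case=> _ /inP_word[u' pu' zu] /inP_word[v' pv' zv].
have {zu zv} : nf (BS_of c d (u ++ u')) = nf (BS_of c d (v ++ v')).
  by rewrite !BS_of_cat -zu -zv !mulVKg.
rewrite !nf_of !act_cat => /(congr1 fst).
have [//|su [eu _ szu]] := @act_positive u ([::], 0) pu.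
have [//|sv [ev _ szv]] := @act_positive v ([::], 0) pv.
have [m [posu _ ->]] := positive_nf pu.
have [n [posv _ ->]] := positive_nf pv.
have [s [-> _ _]] := act_positive pu' posu.
have [t [-> _ _]] := act_positive pv' posv.
rewrite eu ev !cats0 => st.
have /eqP : t ++ sv == s ++ su by rewrite st.
have sz : size su = size sv by apply/eqP; rewrite -eqz_nat szu szv uv.
have /(congr1 (drop (size s))) := st.
have szst : size s = size t.
  by have /(congr1 size) := st; rewrite !size_cat sz => /addIn.
rewrite drop_size_cat // szst drop_size_cat // => <-.
have [mn|nm] := leqP m n; [left; exists (n - m)%N|right; exists (m - n)%N].
  by rewrite -mulgA -expgnDr subnKC.
by rewrite -mulgA -expgnDr subnKC // ltnW.
Qed.

(** A positive word can be cut after its k-th a. *)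
Lemma inP_split (x : G) (k : nat) : inP x -> k%:Z <= theta x ->
  exists g h, [/\ inP g, inP h, theta g = k & x = (g * h)%g].
Proof.
case/inP_word => w pw ->; rewrite theta_of.
elim: w k pw => [|[g i] w IH] [|k] pw.
- by exists 1%g, 1%g; rewrite theta1 mulg1; split => //; exact: inP_1.
- by rewrite /exp_sum big_nil.
- move=> _; exists 1%g, (BS_of c d ((g, i) :: w)); rewrite theta1 mul1g.
  by split=> //; [exact: inP_1 | exact: word_inP].
move: pw => /=; case: i => //= pw.
rewrite /exp_sum big_cons -/(exp_sum w) -cat1s BS_of_cat; case: g => /=.
  rewrite expr0 => kw.
  have [|g [h [Pg Ph tg ->]]] := IH k pw; first by lia.
  exists (a * g)%g, h; split => //; last exact: mulgA.
    by apply: inP_mul => //; exact: inP_a.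
  by rewrite thetaM theta_a tg.
rewrite add0r => /(IH _ pw)[g [h [Pg Ph tg ->]]].
exists (b * g)%g, h; split => //; last exact: mulgA.
  by apply: inP_mul => //; exact: inP_b.
by rewrite thetaM theta_b tg add0r.
Qed.

Lemma BSle_refl (x : G) : BSle x x.
Proof. by rewrite /BSle mulVg; exact: inP_1. Qed.

Lemma BSle_trans (y x z : G) : BSle x y -> BSle y z -> BSle x z.
Proof.
by move=> xy yz; rewrite /BSle -(mulVKg y z) mulgA; exact: inP_mul.
Qed.

Lemma BSle_mul (x y : G) : inP y -> BSle x (x * y)%g.
Proof. by rewrite /BSle mulKg. Qed.

Lemma BSleP (x z : G) : BSle x z -> exists2 y, inP y & z = (x * y)%g.
Proof. by move=> xz; exists (x^-1 * z)%g => //; rewrite mulVKg. Qed.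

(** Writing w = x v, cut v so that x v1 has the degree of y: then x v1 and y
    lie below w and have equal degree, so they are comparable and the larger
    one is a common upper bound of the form y b^n. *)
Lemma ub_truncate (x y w : G) : inP x -> inP y -> theta x <= theta y ->
  is_ub x y w -> exists2 n, BSle x (y * b ^+ n)%g & BSle (y * b ^+ n)%g w.
Proof.
move=> Px Py xy [Pw xw yw].
have [v Pv wE] := BSleP xw.
have kv : (`|theta y - theta x|%N)%:Z <= theta v.
  have := inP_theta_ge0 yw; rewrite theta_mulVg wE thetaM; lia.
have [v1 [v2 [P1 P2 t1 vE]]] := inP_split Pv kv.
have Pz : inP (x * v1)%g by exact: inP_mul.
have zw : BSle (x * v1)%g w by rewrite wE vE mulgA; exact: BSle_mul.
have yz : theta y = theta (x * v1)%g by rewrite thetaM t1; lia.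
have [|[n e]|[n e]] := ub_comparable Py Pz yz (z := w); first by [].
- by exists n; rewrite -e //; exact: BSle_mul.
- exists 0%N; rewrite mulg1 // e -mulgA; apply: BSle_mul.
  by apply: inP_mul => //; exact: inP_b_exp.
Qed.

(** By [ub_truncate] the least n with x <= y b^n gives the join. *)
Lemma join_exists_le (x y : G) : inP x -> inP y -> theta x <= theta y ->
  ~ join_infty x y -> exists2 z, is_join x y z & theta z = theta y.
Proof.
move=> Px Py xy /existsNP[w /contrapT ubw].
have exn : exists n, `[< BSle x (y * b ^+ n)%g >].
  by have [m xm _] := ub_truncate Px Py xy ubw; exists m; apply/asboolP.
case: (ex_minnP exn) => n /asboolP xn minn.
exists (y * b ^+ n)%g; last by rewrite thetaM theta_b_exp addr0.
split; first split => //.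
- by apply: inP_mul => //; exact: inP_b_exp.
- by apply: BSle_mul; exact: inP_b_exp.
move=> w' /(ub_truncate Px Py xy)[m xm mw].
apply: BSle_trans mw; have nm : (n <= m)%N by apply: minn; apply/asboolP.
by rewrite -(subnKC nm) expgnDr mulgA; apply: BSle_mul; exact: inP_b_exp.
Qed.

Lemma is_joinC (x y z : G) : is_join x y z -> is_join y x z.
Proof. by case=> -[Pz xz yz] H; split=> // w [Pw yw xw]; exact: H. Qed.

Lemma join_exists (x y : G) : inP x -> inP y -> ~ join_infty x y ->
  exists2 z, is_join x y z & theta z = theta x \/ theta z = theta y.
Proof.
move=> Px Py nxy; have [xy|/ltW yx] := leP (theta x) (theta y).
  by have [z] := join_exists_le Px Py xy nxy; exists z; last right.
have [|z /is_joinC zj zx] := join_exists_le Py Px yx; last by exists z; last left.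
by move=> H; apply: nxy => z [Pz xz yz]; exact: (H z).
Qed.

(** An element of P of degree 0 is a power of b, so in equal degree y <= x
    means x = y b^n. *)
Lemma is_join_l (x y : G) : inP x -> inP y ->
  (theta x = theta y /\ is_join x y x) <-> exists n, x = (y * b ^+ n)%g.
Proof.
move=> Px Py; split.
  case=> xy [[_ _ yx] _]; have [|n e] := inP_theta0 yx.
    by rewrite theta_mulVg xy subrr.
  by exists n; rewrite -e mulVKg.
case=> n xE; split; first by rewrite xE thetaM theta_b_exp addr0.
split; last by move=> w [].
split=> //; first exact: BSle_refl.
by rewrite xE; apply: BSle_mul; exact: inP_b_exp.
Qed.

End NormalForms.

(** * Generalities on C*-algebras and states *)

Section CStarFacts.
Variables (R : realType) (A : cstarAlgType R).
Implicit Types (x : A) (psi : {scalar A}).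

Lemma star1 : star (1 : A) = 1.
Proof. by have := starM (star (1 : A)) 1; rewrite !starK !mulr1 starK. Qed.

Lemma star0 : star (0 : A) = 0.
Proof. by have := starZ 0 (0 : A); rewrite conjC0 !scale0r. Qed.

Lemma cnorm0 : cnorm (0 : A) = 0.
Proof. by have := cnormZ 0 (0 : A); rewrite scale0r Normc.normc0 mul0r. Qed.

Lemma cnormN x : cnorm (- x) = cnorm x.
Proof. by rewrite -scaleN1r cnormZ normcN Normc.normc1 mul1r. Qed.

Lemma cnorm_ge0 x : 0 <= cnorm x.
Proof. by have := cnormD x (- x); rewrite subrr cnorm0 cnormN; lra. Qed.

(** Positivity of psi on (1 + u)^* (1 + u) makes psi u + psi (u^* ) real; the
    cases u = a and u = i a together determine psi (a^* ). *)
Lemma state_star psi a : is_state psi -> psi (star a) = Num.conj (psi a).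
Proof.
case=> psi_ge0 _ psi1.
have Im_sum u : complex.Im (psi u + psi (star u)) = 0.
  have := psi_ge0 (1 + u); rewrite starD star1 mulrDl mul1r mulrDr mulr1.
  have := psi_ge0 u; set v := psi (star u * u) => v_ge0.
  rewrite !linearD /= psi1 -/v.
  by move/ger0_Im; rewrite !linearD /= (ger0_Im v_ge0) addr0 add0r.
have := Im_sum a; have := Im_sum ('i%C *: a).
rewrite starZ !linearZ /=.
case: (psi a) (psi (star a)) => [u1 u2] [v1 v2] /=.
by simpc => /= H1 H2; congr Complex; lra.
Qed.

Definition closed_subspace (V : set A) : Prop :=
  [/\ norm_closed V, V 0, forall u v, V u -> V v -> V (u + v)
    & forall (k : R[i]) v, V v -> V (k *: v)].

Lemma norm_closed_lmul (V : set A) (a : A) :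
  norm_closed V -> norm_closed (fun v => V (a * v)).
Proof.
move=> Vcl v vcl; apply: Vcl => e e0.
have a1 : 0 < cnorm a + 1 by have := cnorm_ge0 a; lra.
have [u Vu ue] := vcl (e / (cnorm a + 1)) (divr_gt0 e0 a1).
exists (a * u) => //; rewrite -mulrBr.
apply: le_lt_trans (cnormM _ _) _.
rewrite ltr_pdivlMr // in ue.
have := cnorm_ge0 (v - u); nra.
Qed.

Lemma norm_closed_rmul (V : set A) (v : A) :
  norm_closed V -> norm_closed (fun a => V (a * v)).
Proof.
move=> Vcl a acl; apply: Vcl => e e0.
have v1 : 0 < cnorm v + 1 by have := cnorm_ge0 v; lra.
have [u Vu ue] := acl (e / (cnorm v + 1)) (divr_gt0 e0 v1).
exists (u * v) => //; rewrite -mulrBl.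
apply: le_lt_trans (cnormM _ _) _.
rewrite ltr_pdivlMr // in ue.
have := cnorm_ge0 (a - u); nra.
Qed.

Lemma cnorm_starE (u : A) : cnorm (star u) = cnorm u.
Proof.
have le w : cnorm (w : A) <= cnorm (star w).
  have := cnorm_star w; have := cnormM (star w) w; have := cnorm_ge0 w.
  have := cnorm_ge0 (star w); nra.
by apply/eqP; rewrite eq_le le -{2}[u]starK le.
Qed.

End CStarFacts.

(** * Products of monomials in a Nica-covariant representation *)

Section Nica.
Variables (R : realType) (c d : nat) (hc : (0 < c)%N) (hd : (0 < d)%N).
Variables (A : cstarAlgType R) (T : BS c d -> A).
Hypothesis nT : nica_covariant T.
Local Notation G := (BS c d).
Local Notation b := (BSb c d).
Implicit Types (x y p q : G).

Lemma nica_isom x : inP x -> star (T x) * T x = 1.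
Proof. by case: nT => H _ _ _ _; exact: H. Qed.

Lemma nica1 : T 1%g = 1.
Proof. by case: nT. Qed.

Lemma nicaM x y : inP x -> inP y -> T (x * y)%g = T x * T y.
Proof. by case: nT => _ _ H _ _; exact: H. Qed.

(** Insert T_x^* T_x = 1 and T_y^* T_y = 1 around the range projections; the
    same device gives [nica_join]. *)
Lemma nica_disjoint x y : inP x -> inP y -> join_infty x y ->
  star (T x) * T y = 0.
Proof.
move=> Px Py xy; case: nT => _ _ _ _ /(_ x y Px Py xy) T0.
have : star (T x) * (T x * star (T x) * (T y * star (T y))) * T y = 0.
  by rewrite T0 mulr0 mul0r.
by rewrite !mulrA nica_isom // mul1r -!mulrA nica_isom // mulr1.
Qed.

Lemma nica_join x y x' y' : inP x -> inP y -> inP x' -> inP y' ->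
  (x * x' = y * y')%g -> is_join x y (x * x')%g ->
  star (T x) * T y = T x' * star (T y').
Proof.
move=> Px Py Px' Py' e j; case: nT => _ _ _ /(_ x y _ Px Py j) Tj _.
have : star (T x) * (T x * star (T x) * (T y * star (T y))) * T y
     = star (T x) * (T (x * x')%g * star (T (x * x')%g)) * T y by rewrite Tj.
rewrite !mulrA nica_isom // mul1r -!mulrA nica_isom // mulr1 => ->.
rewrite {2}e !nicaM // starM !mulrA nica_isom // mul1r -!mulrA.
by rewrite nica_isom // mulr1.
Qed.

(** The last clause of [NicaJoin], from the degree of the join, is what makes
    the degree count in [formula_twist] work. *)
Variant nica_product_spec x y : A -> Prop :=
| NicaDisjoint of join_infty x y : nica_product_spec x y 0
| NicaJoin x' y' of inP x' & inP y' & (x * x' = y * y')%g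
    & is_join x y (x * x')%g & theta x' = 0 \/ theta y' = 0 :
    nica_product_spec x y (T x' * star (T y')).

Lemma nica_productP x y : inP x -> inP y ->
  nica_product_spec x y (star (T x) * T y).
Proof.
move=> Px Py; have [xy|xy] := pselect (join_infty x y).
  by rewrite nica_disjoint //; constructor.
have [z zj tz] := join_exists hc hd Px Py xy.
have [[_ /BSleP[x' Px' zx] /BSleP[y' Py' zy]] _] := zj.
have e : (x * x' = y * y')%g by rewrite -zx.
move: zj; rewrite zx => zj.
rewrite (nica_join Px Py Px' Py' e zj); constructor => //.
by case: tz; [rewrite zx | rewrite zy]; rewrite thetaM => H; [left|right]; lia.
Qed.

(** Including 0 makes this class stable under products with T_x and T_x^*. *)
Variant monomial : A -> Prop :=
| MonoZero : monomial 0
| Mono x y of inP x & inP y : monomial (T x * star (T y)).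

Lemma monomial_star v : monomial v -> monomial (star v).
Proof.
by case=> [|x y Px Py]; rewrite ?star0 ?starM ?starK; constructor.
Qed.

Lemma monomial_mulT x v : inP x -> monomial v -> monomial (T x * v).
Proof.
move=> Px [|p q Pp Pq]; first by rewrite mulr0; constructor.
by rewrite mulrA -nicaM //; constructor => //; exact: inP_mul.
Qed.

Lemma monomial_mulTstar x v : inP x -> monomial v -> monomial (star (T x) * v).
Proof.
move=> Px [|p q Pp Pq]; first by rewrite mulr0; constructor.
rewrite mulrA; case: (nica_productP Px Pp) => [_|x' p' Px' Pp' _ _ _].
  by rewrite mul0r; constructor.
rewrite -mulrA -starM -nicaM //; constructor => //; exact: inP_mul.
Qed.

Lemma monomial_Tmul x v : inP x -> monomial v -> monomial (v * T x).
Proof.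
move=> Px mv; rewrite -[v * _]starK starM; apply: monomial_star.
by apply: monomial_mulTstar => //; exact: monomial_star.
Qed.

Lemma monomialT x : inP x -> monomial (T x).
Proof.
move=> Px; rewrite -[T x]mulr1 -[1]star1 -nica1; constructor => //.
exact: inP_1.
Qed.

(** * The formula for psi on monomials *)

Variables (psi : {scalar A}) (beta : R).
Hypothesis hpsi : is_state psi.

Definition boltzmann (n : int) : R[i] := (expR (- beta * n%:~R))%:C.

Lemma boltzmannD m n : boltzmann (m + n) = boltzmann m * boltzmann n.
Proof. by rewrite /boltzmann intrD mulrDr expRD rmorphM. Qed.

Lemma boltzmann0 : boltzmann 0 = 1.
Proof. by rewrite /boltzmann mulr0 expR0. Qed.

Lemma boltzmannV n : boltzmann (- n) * boltzmann n = 1.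
Proof. by rewrite -boltzmannD addNr boltzmann0. Qed.

Lemma boltzmann_conj n : Num.conj (boltzmann n) = boltzmann n.
Proof. exact: conjc_real. Qed.

Lemma boltzmann_eq1 n : boltzmann n = 1 -> beta = 0 \/ n = 0.
Proof.
case=> e; have /eqP : - beta * n%:~R = 0 by apply: expR_inj; rewrite e expR0.
rewrite mulf_eq0 oppr_eq0 intr_eq0.
by case/orP => /eqP; [left|right].
Qed.

(** The formula of the theorem with its order-theoretic conditions replaced by
    equations in the group, which is the form suited to calculation. *)
Definition comparison_formula : Prop := forall x y, inP x -> inP y ->
  [/\ forall n, x = (y * b ^+ n)%g ->
        psi (T x * star (T y)) = boltzmann (theta x) * psi (T (b ^+ n)%g),
      forall n, y = (x * b ^+ n)%g ->
        psi (T x * star (T y)) = boltzmann (theta x) * psi (star (T (b ^+ n)%g))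
    & (forall n, x <> (y * b ^+ n)%g) -> (forall n, y <> (x * b ^+ n)%g) ->
        psi (T x * star (T y)) = 0].

(** The first two cases overlap for x = y only, because b has infinite order,
    and there they give the same value. *)
Lemma comparison_formulaE :
  (forall x y, inP x -> inP y ->
    psi (T x * star (T y)) =
      if `[< theta x = theta y /\ is_join x y x >] then
        boltzmann (theta x) * psi (T (y^-1 * x)%g)
      else if `[< theta x = theta y /\ is_join x y y >] then
        boltzmann (theta x) * psi (star (T (x^-1 * y)%g))
      else 0) <-> comparison_formula.
Proof.
have joinr x y : inP x -> inP y ->
    (theta x = theta y /\ is_join x y y) <-> exists n, y = (x * b ^+ n)%g.
  move=> Px Py; rewrite -(is_join_l Py Px).
  by split=> -[e /is_joinC j]; split.
split=> F x y Px Py; last first.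
  have [F1 F2 F3] := F x y Px Py.
  case: asboolP => [/(is_join_l Px Py)[n xE]|nx].
    by rewrite (F1 n) //; congr (_ * psi (T _)); rewrite xE mulKg.
  case: asboolP => [/(joinr x y Px Py)[n yE]|ny].
    by rewrite (F2 n) //; congr (_ * psi (star (T _))); rewrite yE mulKg.
  apply: F3 => n e; [apply: nx; apply/(is_join_l Px Py)|apply: ny; apply/joinr => //];
  by exists n.
split=> [n e|n e|nx ny]; rewrite F //.
- rewrite asboolT; first by congr (_ * psi (T _)); rewrite e mulKg.
  by apply/(is_join_l Px Py); exists n.
- case: asboolP => [/(is_join_l Px Py)[m e']|_].
    (* x <= y and y <= x force x = y: the powers of b involved cancel *)
    have /(b_exp_inj hc hd) : (b ^+ 0 = b ^+ (n + m))%g.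
      by apply: (mulgI x); rewrite mulg1 {1}e' e -mulgA -expgnDr.
    move/eqP; rewrite eq_sym addn_eq0 => /andP[/eqP n0 /eqP m0].
    by move: e; rewrite n0 mulg1 => ->; rewrite mulVg nica1 star1.
  rewrite asboolT; first by congr (_ * psi (star (T _))); rewrite e mulKg.
  by apply/joinr => //; exists n.
rewrite !asboolF //.
- by move/(joinr x y Px Py) => [n] /ny.
- by move/(is_join_l Px Py) => [n] /nx.
Qed.


(** * KMS states satisfy the formula *)

Section Dynamics.
Variable alpha : R -> {lrmorphism A -> A}.
Hypothesis halpha : is_theta_dynamics T alpha.

Lemma alpha_mono t x y : inP x -> inP y ->
  alpha t (T x * star (T y)) =
  expi (t * (theta x - theta y)%:~R) *: (T x * star (T y)).
Proof.
case: halpha => -[alpha_star _ _ _ _] aT Px Py.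
rewrite rmorphM /= (alpha_star t (T y)) !aT // starZ -scalerAl -scalerAr scalerA.
congr (_ *: _); rewrite intrB mulrBr /expi cosB sinB.
apply/eqP; rewrite eq_complex /=; apply/andP; split; apply/eqP; ring.
Qed.

(** The flow multiplies the monomial by a nontrivial character of the line. *)
Lemma invariant_degree x y : (forall t v, psi (alpha t v) = psi v) ->
  inP x -> inP y -> theta x <> theta y -> psi (T x * star (T y)) = 0.
Proof.
move=> inv Px Py xy.
(* at this time the character takes the value -1 *)
have := inv (pi / (theta x - theta y)%:~R) (T x * star (T y)).
have xy0 : (theta x - theta y)%:~R != 0 :> R.
  by rewrite intr_eq0 subr_eq0; apply/eqP.
rewrite alpha_mono // divfK // /expi cospi sinpi linearZ /=.
have -> : -1 +i* 0 = -1 :> R[i] by apply/eqP; rewrite eq_complex /= oppr0 !eqxx.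
rewrite mulN1r => /eqP; rewrite eq_sym -addr_eq0 -mulr2n mulrn_eq0 /=.
by move/eqP.
Qed.

(** For beta <> 0 the KMS condition against the unit already gives this. *)
Lemma KMS_degree x y : is_KMS T alpha beta psi ->
  inP x -> inP y -> theta x <> theta y -> psi (T x * star (T y)) = 0.
Proof.
case=> _ kms inv Px Py xy.
have [beta0|/eqP beta0] := eqVneq beta 0.
  by apply: invariant_degree => //; exact: inv.
have := kms x y 1%g 1%g Px Py (inP_1 c d) (inP_1 c d).
rewrite nica1 star1 !mulr1 mul1r -/(boltzmann _) => /eqP.
rewrite -subr_eq0 -{1}[psi _]mul1r -mulrBl mulf_eq0 => /orP[|/eqP //].
rewrite subr_eq0 eq_sym => /eqP /boltzmann_eq1[//|/eqP].
by rewrite subr_eq0 => /eqP.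
Qed.

(** The KMS condition for T_x and T_y^* trades psi (T_x T_y^* ) for
    psi (T_y^* T_x), where Nica covariance applies. *)
Lemma KMS_comparison : is_KMS T alpha beta psi -> comparison_formula.
Proof.
move=> kms x y Px Py.
have flip : psi (T x * star (T y)) = boltzmann (theta x) * psi (star (T y) * T x).
  case: kms => _ kms _.
  have := kms x 1%g 1%g y Px (inP_1 c d) (inP_1 c d) Py.
  by rewrite nica1 star1 mulr1 !mul1r theta1 subr0.
split=> [n e|n e|nx ny].
- rewrite flip {2}e nicaM //; last exact: inP_b_exp.
  by rewrite mulrA nica_isom // mul1r.
- rewrite flip {1}e nicaM //; last exact: inP_b_exp.
  by rewrite starM -mulrA nica_isom // mulr1.
- have [xy|/eqP xy] := eqVneq (theta x) (theta y); last exact: KMS_degree.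
  rewrite flip nica_disjoint ?linear0 ?mulr0 // => z [Pz yz xz].
  have ub : is_ub x y z by [].
  by case: (ub_comparable hc hd Px Py xy ub) => -[n] => [/ny|/nx].
Qed.

End Dynamics.

(** * The formula implies the KMS condition *)

Hypothesis formula : comparison_formula.

(** With q q' = x x' the join of q and x, the left side is the value of the
    formula at the pair (x p, q), the right one its value at (p q', x').
    Multiplication by x and q' turns a relation x p = q b^n into
    p q' = x' b^n and conversely, provided that q' commutes with b; in all
    cases that matter q' is itself a power of b. *)
Lemma formula_twist x p q : inP x -> inP p -> inP q ->
  psi (T x * (T p * star (T q)))
  = boltzmann (theta x) * psi (T p * star (T q) * T x).
Proof.
move=> Px Pp Pq; rewrite mulrA -nicaM // -mulrA.
have Pxp : inP (x * p)%g by exact: inP_mul.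
have [L1 L2 L3] := formula Pxp Pq.
case: (nica_productP Pq Px) => [qx|q' x' Pq' Px' e [_ jle] deg].
  (* if x p and q were comparable, the larger would bound both q and x *)
  rewrite mulr0 linear0 mulr0; apply: L3 => n e.
    apply: (qx (x * p)%g); split=> //; last exact: BSle_mul.
    by rewrite e; apply: BSle_mul; exact: inP_b_exp.
  apply: (qx q); split=> //; first exact: BSle_refl.
  by rewrite e -mulgA; apply: BSle_mul; apply: inP_mul => //; exact: inP_b_exp.
rewrite mulrA -nicaM //.
have Ppq : inP (p * q')%g by exact: inP_mul.
have [R1 R2 R3] := formula Ppq Px'.
have tq := inP_theta_ge0 Pq'; have tx := inP_theta_ge0 Px'.
have tp := inP_theta_ge0 Pp.
have te := congr1 (@theta c d) e; rewrite !thetaM in te.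
(* q' or x' has degree 0; if x' does, then so does p q', hence also q' *)
have powb : theta (p * q')%g = theta x' -> exists i, q' = (b ^+ i)%g.
  by rewrite thetaM => H; apply: inP_theta0 => //; case: deg; lia.
have comm i n : ((b ^+ i) * (b ^+ n) = (b ^+ n) * (b ^+ i) :> G)%g.
  by rewrite -!expgnDr addnC.
have [[n xpE]|nxp] := pselect (exists n, x * p = q * b ^+ n)%g.
  have [i qE] : exists i, q' = (b ^+ i)%g.
    have : BSle (q * q')%g (x * p)%g.
      apply: jle.
      split=> //; last exact: BSle_mul.
      by rewrite xpE; apply: BSle_mul; exact: inP_b_exp.
    move=> /inP_theta_ge0; rewrite theta_mulVg xpE !thetaM theta_b_exp => H.
    by apply: inP_theta0 => //; lia.
  have pqE : (p * q' = x' * b ^+ n)%g.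
    by apply: (mulgI x); rewrite !mulgA xpE -e qE -!mulgA comm.
  rewrite (L1 n) // (R1 n) // mulrA -boltzmannD; congr (boltzmann _ * _).
  by have := congr1 (@theta c d) pqE; rewrite !thetaM theta_b_exp; lia.
have [[n qxE]|nqx] := pselect (exists n, q = x * p * b ^+ n)%g.
  have [i qE] : exists i, q' = (b ^+ i)%g.
    have : BSle (q * q')%g q.
      apply: jle.
      split=> //; first exact: BSle_refl.
      by rewrite qxE -mulgA; apply: BSle_mul; apply: inP_mul => //; exact: inP_b_exp.
    move=> /inP_theta_ge0; rewrite theta_mulVg !thetaM => H.
    by apply: inP_theta0 => //; lia.
  have pqE : (x' = p * q' * b ^+ n)%g.
    by apply: (mulgI x); rewrite -e {1}qxE qE -!mulgA comm.
  rewrite (L2 n) // (R2 n) // mulrA -boltzmannD; congr (boltzmann _ * _).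
  by rewrite qE !thetaM theta_b_exp addr0.
(* a comparison of p q' and x' would give one of x p and q *)
rewrite L3; [|by move=> n H; apply: nxp; exists n|by move=> n H; apply: nqx; exists n].
rewrite R3 ?mulr0 // => n E.
- have [|i qE] := powb; first by rewrite E thetaM theta_b_exp addr0.
  apply: nxp; exists n; apply: (mulIg (b ^+ i)%g).
  by rewrite -mulgA -qE E mulgA -e qE -!mulgA comm.
- have [|i qE] := powb; first by rewrite E [RHS]thetaM theta_b_exp addr0.
  apply: nqx; exists n; apply: (mulIg (b ^+ i)%g).
  by rewrite -qE e E qE -!mulgA comm.
Qed.


Lemma monomial_twist x v : inP x -> monomial v ->
  psi (T x * v) = boltzmann (theta x) * psi (v * T x).
Proof.
move=> Px [|p q Pp Pq]; last exact: formula_twist.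
by rewrite mulr0 mul0r linear0 mulr0.
Qed.

Lemma monomial_twist_star x v : inP x -> monomial v ->
  psi (star (T x) * v) = boltzmann (- theta x) * psi (v * star (T x)).
Proof.
move=> Px mv.
have := monomial_twist Px (monomial_star mv).
move/(congr1 Num.conj); rewrite rmorphM /= boltzmann_conj -!state_star // !starM !starK.
by move=> ->; rewrite mulrA boltzmannV mul1r.
Qed.

(** Move T_x and then T_y^* around; the factors that remain are monomials at
    each stage. *)
Lemma formula_KMS x y p q : inP x -> inP y -> inP p -> inP q ->
  psi ((T x * star (T y)) * (T p * star (T q))) =
  boltzmann (theta x - theta y) * psi ((T p * star (T q)) * (T x * star (T y))).
Proof.
move=> Px Py Pp Pq; have mpq : monomial (T p * star (T q)) by constructor.
rewrite -[LHS]/(psi _) -mulrA monomial_twist //; last exact: monomial_mulTstar.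
rewrite -mulrA monomial_twist_star //; last exact: monomial_Tmul.
by rewrite mulrA -boltzmannD mulrA.
Qed.

(** The closed linear span, as the intersection of all closed subspaces
    containing the monomials: membership is then proved by exhibiting one
    closed subspace, with no approximation argument. *)
Definition monomial_span (v : A) : Prop :=
  forall V : set A, closed_subspace V -> (forall m, monomial m -> V m) -> V v.

Lemma closed_subspace_span : closed_subspace monomial_span.
Proof.
split.
- move=> v vcl V HV mV; have [Vcl _ _ _] := HV; apply: Vcl => e e0.
  by have [u uS ue] := vcl e e0; exists u => //; exact: uS.
- by move=> V [].
- by move=> u v uS vS V HV mV; have [_ _ VD _] := HV; apply: VD; [exact: uS|exact: vS].
- by move=> k v vS V HV mV; have [_ _ _ VZ] := HV; apply: VZ; exact: vS.
Qed.

Lemma span_lmul (a : A) : (forall m, monomial m -> monomial_span (a * m)) ->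
  forall v, monomial_span v -> monomial_span (a * v).
Proof.
move=> am v /(_ (fun v => monomial_span (a * v))); apply => //.
have [Scl S0 SD SZ] := closed_subspace_span.
split; first exact: norm_closed_lmul.
- by rewrite mulr0.
- by move=> u w; rewrite mulrDr; exact: SD.
- by move=> k w; rewrite -scalerAr; exact: SZ.
Qed.

(** The elements a such that a and a^* multiply the span into itself form a
    closed unital *-subalgebra containing every T_x, hence everything; apply
    this to 1. *)
Lemma monomial_span_full : generates [set T x | x in @inP c d] ->
  forall v, monomial_span v.
Proof.
have [Scl S0 SD SZ] := closed_subspace_span.
have Sm m : monomial m -> monomial_span m by move=> mm V _; apply.
have m1 : monomial 1 by rewrite -nica1; apply: monomialT; exact: inP_1.
pose C : set A := fun a => forall v, monomial_span v ->
  monomial_span (a * v) /\ monomial_span (star a * v).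
move=> /(_ C) gen v; suff CE : C = setT.
  by have : C v by [rewrite CE]; move=> /(_ 1 (Sm 1 m1))[]; rewrite mulr1.
apply: gen.
- move=> a acl w Sw; split.
    apply: (@norm_closed_rmul _ _ _ w Scl) => e /acl[u Cu ue]; exists u => //.
    by case: (Cu w Sw).
  apply: (@norm_closed_rmul _ _ _ w Scl) => e /acl[u Cu ue]; exists (star u).
    by case: (Cu w Sw).
  have -> : star a - star u = star (a - u).
    by rewrite starD -[- u]scaleN1r starZ rmorphN rmorph1 scaleN1r.
  by rewrite cnorm_starE.
- move=> _ [x Px <-] w Sw; split; apply: span_lmul Sw => m mm; apply: Sm.
    exact: monomial_mulT.
  exact: monomial_mulTstar.
- by move=> w Sw; rewrite star1 mul1r.
- move=> u u' Cu Cu' w Sw; have [? ?] := Cu w Sw; have [? ?] := Cu' w Sw.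
  by rewrite starD !mulrDl; split; exact: SD.
- move=> k u Cu w Sw; have [? ?] := Cu w Sw.
  by rewrite starZ -!scalerAl; split; exact: SZ.
- move=> u u' Cu Cu' w Sw; rewrite starM -!mulrA; split.
    by case: (Cu' w Sw) => /Cu[].
  by case: (Cu w Sw) => _ /Cu'[].
- by move=> u Cu w Sw; rewrite starK; case: (Cu w Sw).
Qed.

Lemma formula_degree x y : inP x -> inP y -> theta x <> theta y ->
  psi (T x * star (T y)) = 0.
Proof.
move=> Px Py xy; have [_ _ F3] := formula Px Py.
by apply: F3 => n e; apply: xy; rewrite e thetaM theta_b_exp addr0.
Qed.

(** The elements on which psi and psi o alpha_t agree form a closed subspace,
    since both are continuous; on a monomial either the degree is 0 and
    alpha_t fixes it, or both values vanish. *)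
Lemma formula_invariant (alpha : R -> {lrmorphism A -> A}) t v :
  is_theta_dynamics T alpha -> generates [set T x | x in @inP c d] ->
  psi (alpha t v) = psi v.
Proof.
move=> halpha gen.
apply: (@monomial_span_full gen v (fun v => psi (alpha t v) = psi v)); last first.
  move=> _ [|x y Px Py]; first by rewrite !linear0.
  rewrite (alpha_mono halpha) // linearZ /=.
  have [xy|/eqP xy] := eqVneq (theta x) (theta y).
    by rewrite xy subrr mulr0 /expi cos0 sin0 mul1r.
  by rewrite formula_degree // mulr0.
have [[_ alpha_norm _ _ _] _] := halpha.
have [_ psi_norm _] := hpsi.
split.
- move=> w wcl; apply/eqP; rewrite -subr_eq0; apply/eqP.
  apply: Normc.eq0_normc; apply/eqP; rewrite eq_le andbC; apply/andP; split.
    by case: (_ - _) => ? ?; exact: sqrtr_ge0.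
  apply/ler_addgt0Pl => e e0; rewrite addr0.
  have [u ue uw] := wcl (e / 2) (divr_gt0 e0 (ltr0Sn R 1)).
  have -> : psi (alpha t w) - psi w = psi (alpha t (w - u)) - psi (w - u).
    by rewrite !linearB /= ue; ring.
  apply: le_trans (le_normcD _ _) _; rewrite normcN.
  have := psi_norm (alpha t (w - u)); have := psi_norm (w - u).
  rewrite alpha_norm; lra.
- by rewrite !linear0.
- by move=> u w eu ew; rewrite !linearD /= eu ew.
- by move=> k w ew; rewrite !linearZ /= ew.
Qed.

End Nica.

Theorem proposition5p1 (R : realType) (c d : nat) (hc : (0 < c)%N)
    (hd : (0 < d)%N) (A : cstarAlgType R) (T : BS c d -> A)
    (hT : is_universal_nica T) (alpha : R -> {lrmorphism A -> A})
    (halpha : is_theta_dynamics T alpha)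
    (beta : R) (psi : {scalar A}) (hpsi : is_state psi) :
  is_KMS T alpha beta psi <->
  (forall x y : BS c d, inP x -> inP y ->
    psi (T x * star (T y)) =
      if `[< theta x = theta y /\ is_join x y x >] then
        (expR (- beta * (theta x)%:~R))%:C * psi (T (y^-1 * x)%g)
      else if `[< theta x = theta y /\ is_join x y y >] then
        (expR (- beta * (theta x)%:~R))%:C * psi (star (T (x^-1 * y)%g))
      else 0).
Proof.
have [nT gen _] := hT.
rewrite (comparison_formulaE hc hd nT psi beta); split=> [|F].
  exact: (KMS_comparison hc hd nT halpha).
split=> // [x y p q|_ t v]; first exact: (formula_KMS hc hd nT hpsi F).
exact: (formula_invariant hc hd nT hpsi F).
Qed.
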